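(* Let $a_0$, $A$, $B$ be positive real numbers, put $a_1 = A a_0 + B$ and $a_n = A^{n-1} a_1$ for $n \geq 2$, so that $\sum_{k=0}^\infty a_k z^k$ converges to \[ f(z) = \frac{a_0 + Bz}{1 - Az} \] for $|z| < 1/A$. Let $s_n(f;z) = \sum_{k=0}^n a_k z^k$. Let $C$ be the unit circle, let $\delta > 0$ and let $R_\delta$ be the open set of all points within distance $\delta$ of the negative real axis, and let $\{z_{k,n}\}_{k=1}^n$ be the zeros of the polynomial $s_n(f;z/A)$. Then \[ \operatorname{maxdist}\bigl(\{z_{k,n}\}_{k=1}^n \setminus R_\delta,\, C\bigr) = O(1/n) \quad (n\to\infty). \]
   Context: For $\Omega \subseteq \mathbb{C}$ and a curve $C$, $\operatorname{maxdist}(\Omega, C) = \sup_{z\in\Omega} \operatorname{dist}(z, C)$. *)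

(* Defs.v *)
From mathcomp Require Export all_boot all_order all_algebra.
From mathcomp Require Export complex.
From mathcomp Require Export all_classical all_reals all_analysis.

Set Implicit Arguments.
Unset Strict Implicit.
Unset Printing Implicit Defensive.

Import Order.TTheory GRing.Theory Num.Theory.
Import numFieldNormedType.Exports.

Local Open Scope classical_set_scope.
Local Open Scope ring_scope.
Local Open Scope complex_scope.

Section Defs.
Variable R : realType.

Definition cdist (z : R[i]) (S : set R[i]) : R :=
  inf [set Normc.normc (z - w) | w in S].

(* Real-valued [sup] is 0 on the empty set. It is also 0 on unbounded sets, so
   maxdist is meaningful only when the distances are bounded on Omega, e.g. when
   Omega consists of zeros of a nonzero polynomial. *)
Definition maxdist (Omega S : set R[i]) : R :=
  sup [set cdist z S | z in Omega].

Definition unit_circle : set R[i] := [set z | Normc.normc z = 1].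

Definition negative_real_axis : set R[i] := [set x%:C | x in [set x : R | x < 0]].

Definition near_negative_axis (delta : R) : set R[i] :=
  [set z | cdist z negative_real_axis < delta].

Definition partial_sum (a : nat -> R) (n : nat) : {poly R[i]} :=
  \poly_(k < n.+1) (a k)%:C.

Definition poly_zeros (p : {poly R[i]}) : set R[i] := [set z | root p z].

End Defs.

Arguments unit_circle R _ : clear implicits.
Arguments negative_real_axis R _ : clear implicits.

(* Main.v *)
Require Import Defs.
From mathcomp Require Import ring lra.
Set Implicit Arguments.
Unset Strict Implicit.
Unset Printing Implicit Defensive.

Import Order.TTheory GRing.Theory Num.Theory.
Import numFieldNormedType.Exports.
Local Open Scope classical_set_scope.
Local Open Scope ring_scope.
Local Open Scope complex_scope.

(** Multiplying by [1 - A z] telescopes the partial sums to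
    [a_0 + B z - a_1 z (A z)^n], which gives the convergence. It also shows
    that a zero [z] of [s_n(f; z/A)] satisfies [a_1 z^(n+1) = B z + A a_0].
    As [a_1 = B + A a_0], comparing moduli forces [|z| <= 1]. The zero
    [- A a_0 / B] of the right-hand side lies on the negative axis, so away
    from that axis [a_1 |z|^(n+1) >= B delta]: thus [|z|^(n+1)] is bounded
    below by a positive constant, whence [1 - |z| = O(1/n)]. *)

Lemma realC_eq0 (R : rcfType) (x : R) : (x%:C == 0) = (x == 0).
Proof. by rewrite eq_complex/= eqxx andbT. Qed.

Lemma normc_real (R : rcfType) (x : R) : Normc.normc x%:C = `|x|.
Proof. by rewrite /= expr0n addr0 sqrtr_sqr. Qed.

Lemma normcX (R : rcfType) (z : R[i]) n :
  Normc.normc (z ^+ n) = Normc.normc z ^+ n.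
Proof.
elim: n => [|n IHn]; first by rewrite !expr0 Normc.normc1.
by rewrite !exprS Normc.normcM IHn.
Qed.

Lemma normc_ge0 (R : rcfType) (z : R[i]) : 0 <= Normc.normc z.
Proof. by case: z => x y; exact: sqrtr_ge0. Qed.

Lemma complex_cvg_expr (R : realType) (z : R[i]) : Normc.normc z < 1 ->
  (fun n : nat => z ^+ n : R[i]^o) @ \oo --> (0 : R[i]^o).
Proof.
(* The tolerance is a positive element of [R[i]], which forces its imaginary part [e'] to be 0; what
   remains is the real sequence of powers of the modulus. *)
move=> z_lt1; apply/cvgrPdist_lt => -[e e']; rewrite ltcE /= => /andP[/eqP-> e0].
have := @cvg_expr R (Normc.normc z).
rewrite ger0_norm ?normc_ge0// => /(_ z_lt1)/cvgrPdist_lt/(_ _ e0).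
apply: filterS => n; rewrite !sub0r !normrN ger0_norm ?exprn_ge0 ?normc_ge0//.
move=> zn; have -> : `|z ^+ n : R[i]^o| = (Normc.normc (z ^+ n))%:C by [].
by rewrite ltcR normcX.
Qed.

Lemma cdist_ge0 (R : realType) (z : R[i]) (S : set R[i]) : 0 <= cdist z S.
Proof.
have [->|S0] := eqVneq S set0; first by rewrite /cdist image_set0 inf0.
apply: lb_le_inf; last by move=> _ [w _ <-]; exact: normc_ge0.
by move/set0P: S0 => [w Sw]; exists (Normc.normc (z - w)), w.
Qed.

Lemma cdist_le (R : realType) (z w : R[i]) (S : set R[i]) :
  S w -> cdist z S <= Normc.normc (z - w).
Proof.
move=> Sw; apply: ge_inf; last by exists w.
by exists 0 => _ [u _ <-]; exact: normc_ge0.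
Qed.

(** The witness is the radial projection [z / r%:C], which lies on the circle because [z != 0]. *)
Lemma cdist_unit_circle (R : realType) (z : R[i]) : z != 0 ->
  cdist z (unit_circle R) <= `|1 - Normc.normc z|.
Proof.
move=> z0; set r := Normc.normc z.
have r0 : r != 0 by apply: contra_neq z0; exact: Normc.eq0_normc.
have rC : r%:C != 0 by rewrite realC_eq0.
have r_ge0 : 0 <= r := normc_ge0 z.
have nzr : Normc.normc (z / r%:C) = 1.
  by rewrite Normc.normcM Normc.normcV normc_real ger0_norm// divff.
apply: (le_trans (cdist_le z nzr)).
have -> : z - z / r%:C = (r - 1)%:C * (z / r%:C) by rewrite rmorphB/=; field.
by rewrite Normc.normcM nzr mulr1 normc_real distrC.
Qed.

Lemma maxdist_le (R : realType) (Omega S : set R[i]) (K : R) : 0 <= K ->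
  (forall z, Omega z -> cdist z S <= K) -> `|maxdist Omega S| <= K.
Proof.
(* On an empty [Omega] the supremum takes the default value 0, and the bound is [0 <= K] itself. *)
move=> K0 dK; have [->|/set0P[z Oz]] := eqVneq Omega set0.
  by rewrite /maxdist image_set0 sup0 normr0.
have ubK : ubound [set cdist z S | z in Omega] K by move=> _ [w Ow <-]; exact: dK.
rewrite ger0_norm; first by apply: ge_sup => //; exists (cdist z S), z.
apply: (le_trans (cdist_ge0 z S)); apply: ub_le_sup; last by exists z.
by exists K.
Qed.

(** Each of the [n] terms of the geometric sum of the [r ^+ i] is at least [r ^+ n], hence at least
    [q], while the sum times [1 - r] is [1 - r ^+ n <= 1]. This is the source of the rate [1/n]. *)
Lemma expr_lower_bound_dist1 (R : realFieldType) (r q : R) n :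
  0 <= r <= 1 -> q <= r ^+ n -> n%:R * q * (1 - r) <= 1.
Proof.
move=> /andP[r0 r1] qr.
have le_sum : n%:R * q <= \sum_(i < n) r ^+ i.
  rewrite -[X in X%:R * _](card_ord n) mulr_natl -sumr_const.
  apply: ler_sum => i _; apply: (le_trans qr).
  by apply: ler_wiXn2l => //; exact: ltnW.
have rn0 : 0 <= r ^+ n by exact: exprn_ge0.
have := subrX1 r n; have := ler_wpM2r (_ : 0 <= 1 - r) le_sum.
by rewrite subr_ge0 => /(_ r1); lra.
Qed.

Lemma partial_sum_telescope (R : realType) (A B : R) (a : nat -> R) :
  a 1%N = A * a 0%N + B ->
  (forall n : nat, (2 <= n)%N -> a n = A ^+ (n - 1) * a 1%N) ->
  forall (z : R[i]) n, (1 - A%:C * z) * (partial_sum a n).[z] =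
    (a 0%N)%:C + B%:C * z - (a 1%N)%:C * z * (A%:C * z) ^+ n.
Proof.
move=> a1E aE z n.
(* The case [k = 0] covers the index 1, which [aE] leaves out. *)
have aSE k : a k.+1 = A ^+ k * a 1%N.
  by case: k => [|k]; [rewrite mul1r | rewrite aE// subn1].
rewrite /partial_sum horner_poly; elim: n => [|n IHn].
  by rewrite big_ord_recl big_ord0 /= a1E rmorphD rmorphM /=; ring.
rewrite big_ord_recr mulrDr IHn /= (aSE n) rmorphM rmorphXn /= !exprMn !exprS.
by ring.
Qed.

(** The telescoped identity is taken at [z / A], where the partial sum vanishes, and multiplied by
    [A]; the factor [z] outside the power raises the exponent to [n.+1]. *)
Lemma scaled_zero_eq (R : realType) (A B : R) (a : nat -> R) :
  A != 0 -> a 1%N = A * a 0%N + B ->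
  (forall n : nat, (2 <= n)%N -> a n = A ^+ (n - 1) * a 1%N) ->
  forall (z : R[i]) n, root (partial_sum a n \Po ((A^-1)%:C *: 'X)) z ->
    (a 1%N)%:C * z ^+ n.+1 = B%:C * z + (A * a 0%N)%:C.
Proof.
move=> A0 a1E aE z n /eqP; rewrite horner_comp hornerZ hornerX => pz.
have AV : A%:C * (A^-1)%:C = 1 by rewrite -rmorphM/= divff.
have := partial_sum_telescope a1E aE ((A^-1)%:C * z) n.
rewrite pz mulr0 [X in _ - _ * X ^+ _]mulrA AV mul1r.
move=> /(congr1 (fun x => A%:C * x)); rewrite mulr0 => /esym/eqP.
have -> : A%:C * ((a 0%N)%:C + B%:C * ((A^-1)%:C * z) -
    (a 1%N)%:C * ((A^-1)%:C * z) * z ^+ n) =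
  A%:C * (a 0%N)%:C + (A%:C * (A^-1)%:C) * (B%:C * z - (a 1%N)%:C * z ^+ n.+1).
  by rewrite exprS; ring.
by rewrite AV mul1r addrA subr_eq0 rmorphM /= addrC => /eqP.
Qed.

(** Were the modulus [r] above 1, the left side would have modulus at least [(b + c) * r], exceeding
    the bound [b * r + c] for the right side. *)
Lemma zero_normc_le1 (R : realType) (b c : R) (z : R[i]) n :
  0 < b -> 0 < c -> (b + c)%:C * z ^+ n.+2 = b%:C * z + c%:C ->
  Normc.normc z <= 1.
Proof.
move=> b0 c0 zE; rewrite leNgt; apply/negP; set r := Normc.normc z => r1.
have r0 : 0 < r by lra.
have : (b + c) * r ^+ n.+2 <= b * r + c.
  have := congr1 (@Normc.normc R) zE.
  rewrite Normc.normcM normcX normc_real -/r gtr0_norm ?addr_gt0// => ->.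
  apply: le_trans (le_normcD _ _) _.
  by rewrite Normc.normcM !normc_real !gtr0_norm.
have rn : 1 <= r ^+ n by apply: exprn_ege1; exact: ltW.
have -> : r ^+ n.+2 = r ^+ n * r * r by rewrite !exprS; ring.
have : r <= r ^+ n * r * r by nra.
by move=> h1 h2; nra.
Qed.

(** The right side is [b * (z - w)] with [w = - (c / b)] on the negative axis, so its modulus is at
    least [b * delta]. *)
Lemma zero_normcX_ge (R : realType) (b c delta : R) (z : R[i]) n :
  0 < b -> 0 < c -> (b + c)%:C * z ^+ n = b%:C * z + c%:C ->
  ~ near_negative_axis delta z -> b * delta / (b + c) <= Normc.normc z ^+ n.
Proof.
move=> b0 c0 zE /negP; rewrite -leNgt => dz.
have bC : b%:C != 0 by rewrite realC_eq0 gt_eqF.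
have neg : negative_real_axis R (- (c / b))%:C.
  by exists (- (c / b)) => //=; rewrite oppr_lt0 divr_gt0.
have := congr1 (@Normc.normc R) zE.
have -> : b%:C * z + c%:C = b%:C * (z - (- (c / b))%:C).
  have {1}-> : c = b * (c / b) by field; rewrite gt_eqF.
  by rewrite rmorphN rmorphM /=; ring.
rewrite !Normc.normcM normcX !normc_real !gtr0_norm ?addr_gt0// => nE.
rewrite ler_pdivrMr ?addr_gt0// [X in _ <= X]mulrC nE ler_pM2l//.
exact: le_trans dz (cdist_le z neg).
Qed.

Theorem theorem2p4 (R : realType) (A B : R) (a : nat -> R)
  (a0_gt0 : 0 < a 0%N) (A_gt0 : 0 < A) (B_gt0 : 0 < B)
  (a1E : a 1%N = A * a 0%N + B)
  (aE : forall n : nat, (2 <= n)%N -> a n = A ^+ (n - 1) * a 1%N) :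
  (forall z : R[i], Normc.normc z < A^-1 ->
     (fun n : nat => (partial_sum a n).[z] : R[i]^o) @ \oo -->
       (((a 0%N)%:C + B%:C * z) / (1 - A%:C * z) : R[i]^o)) /\
  (forall delta : R, 0 < delta ->
     (fun n : nat =>
        maxdist (poly_zeros (partial_sum a n \Po ((A^-1)%:C *: 'X))
                   `\` near_negative_axis delta)
                (unit_circle R))
     =O_\oo (fun n : nat => n%:R^-1 : R)).
Proof.
split=> [z z_lt|delta delta_gt0].
  have Az : Normc.normc (A%:C * z) < 1.
    by rewrite Normc.normcM normc_real gtr0_norm// mulrC -ltr_pdivlMr// div1r.
  have Az1 : 1 - A%:C * z != 0.
    apply: contraTneq Az => /subr0_eq <-.
    by rewrite Normc.normc1 ltxx.
  (* Dividing the telescoped identity by [1 - A z] leaves the limit minus a multiple of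
     [(A z)^n]. *)
  have -> : (fun n : nat => (partial_sum a n).[z] : R[i]^o) =
      (fun n => ((a 0%N)%:C + B%:C * z) / (1 - A%:C * z) -
         ((a 1%N)%:C * z / (1 - A%:C * z)) * (A%:C * z) ^+ n : R[i]^o).
    apply/funext => n; apply: (mulfI Az1).
    by rewrite (partial_sum_telescope a1E aE); field.
  rewrite -[X in _ --> X]subr0; apply: cvgB; first exact: cvg_cst.
  rewrite -[X in _ --> X](mulr0 ((a 1%N)%:C * z / (1 - A%:C * z))).
  by apply: cvgM; [exact: cvg_cst | exact: complex_cvg_expr].
have c_gt0 : 0 < A * a 0%N by rewrite mulr_gt0.
(* The bound of [zero_normcX_ge] for [b = B] and [c = A * a 0]; its inverse is the constant in the
   [O]. *)
set q := B * delta / (B + A * a 0%N).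
have q_gt0 : 0 < q by rewrite divr_gt0 ?mulr_gt0 ?addr_gt0.
apply/eqO_exP; exists q^-1; first by rewrite invr_gt0.
near=> n.
have n_gt0 : (0 < n)%N by near: n; exact: nbhs_infty_gt.
rewrite [X in _ <= _ * X]ger0_norm ?invr_ge0//.
apply: maxdist_le => [|z [zroot zfar]]; first by rewrite divr_ge0// invr_ge0 ltW.
have := scaled_zero_eq (lt0r_neq0 A_gt0) a1E aE zroot.
rewrite a1E addrC => zE.
(* As [n > 0], the exponent [n.+1] has the form [_.+2] of [zero_normc_le1]. *)
have z_le1 : Normc.normc z <= 1.
  by move: zE; rewrite -(prednK n_gt0); exact: zero_normc_le1.
have qz : q <= Normc.normc z ^+ n.+1 by exact: zero_normcX_ge zE zfar.
have z0 : z != 0.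
  apply/eqP => zE0; move: qz.
  by rewrite zE0 Normc.normc0 expr0n/= leNgt q_gt0.
apply: le_trans (cdist_unit_circle z0) _; rewrite ger0_norm ?subr_ge0//.
have zn : n.+1%:R * q * (1 - Normc.normc z) <= 1.
  by apply: expr_lower_bound_dist1 qz; rewrite normc_ge0.
have nR : 0 < n%:R :> R by rewrite ltr0n.
(* The factor [n.+1] in [zn] is weakened to [n] to match the comparison sequence. *)
rewrite -invfM -[X in _ <= X]mul1r ler_pdivlMr ?(mulr_gt0 q_gt0)//.
apply: le_trans zn; rewrite [X in _ <= X]mulrC ler_wpM2l ?subr_ge0//.
by rewrite mulrC ler_wpM2r ?(ltW q_gt0)// ler_nat.
Unshelve. all: by end_near.
Qed.
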